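(* Let $X,Y,Z,U_J,U_K$ be nonempty sets, and let $J\colon X\times Y\to U_J$ and $K\colon Y\times Z\to U_K$ be functions. Assume that $\operatorname{ran}(J)=\operatorname{ran}(J_1^b)$ for some $b\in X$, and let $F\in\mathcal{F}_{J,K}$. Then there exists a function $g\colon U_K\to\operatorname{ran}(F)$ such that $F=g\circ S_j$ for every $j\in Q(J_1^b)$, where $S_j\colon X\times Y\times Z\to U_K$ is defined by $$S_j(x,y,z)=K(j(J(x,y)),z).$$
   Context: For a function $h$, $\operatorname{dom}(h)$ and $\operatorname{ran}(h)$ denote its domain and range. $\mathcal{F}_{J,K}$ is the class of functions $F\colon X\times Y\times Z\to\operatorname{ran}(F)$ for which there exist $G\colon U_J\times Z\to\operatorname{ran}(F)$ and $H\colon X\times U_K\to\operatorname{ran}(F)$ such that $F(x,y,z)=G(J(x,y),z)=H(x,K(y,z))$ for all $x\in X$, $y\in Y$, $z\in Z$. For $b\in X$, the section $J_1^b\colon Y\to U_J$ is defined by $J_1^b(y)=J(b,y)$. $Q(h)$ denotes the set of quasi-inverses of a function $h$: a function $g$ is a quasi-inverse of $h$ if $\operatorname{ran}(h)\subseteq\operatorname{dom}(g)$, $\operatorname{ran}(g)\subseteq\operatorname{dom}(h)$, $h\circ g|_{\operatorname{ran}(h)}=\mathrm{id}_{\operatorname{ran}(h)}$, and $\operatorname{ran}(g|_{\operatorname{ran}(h)})=\operatorname{ran}(g)$. The Axiom of Choice is assumed, so every function has a quasi-inverse. *)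

(* Defs.v *)
From HB Require Import structures.
From mathcomp Require Import all_boot.
From mathcomp Require Import boolp classical_sets.

Set Implicit Arguments.
Unset Strict Implicit.
Unset Printing Implicit Defensive.

Local Open Scope classical_set_scope.

(* A function whose domain is a subset of A.  The values of [pf_fun] outside
   [pf_dom] are meaningless: the range and the notion of quasi-inverse below
   only involve values on the domain. *)
Record pfun (A B : Type) := PFun { pf_dom : set A; pf_fun :> A -> B }.

Definition pf_ran (A B : Type) (f : pfun A B) : set B := f @` pf_dom f.

Definition pf_total (A B : Type) (f : A -> B) : pfun A B := PFun setT f.

Definition quasi_inverses (A B : Type) (h : pfun A B) : set (pfun B A) :=
  [set g | [/\ pf_ran h `<=` pf_dom g,
               pf_ran g `<=` pf_dom h,
               (forall u, pf_ran h u -> h (g u) = u) &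
               g @` pf_ran h = pf_ran g]].

Section FJK.
Variables X Y Z UJ UK W : Type.
Variables (J : X * Y -> UJ) (K : Y * Z -> UK).

(* [W] is an ambient type for the values of [F]; [G] and [H] take their values
   in the subtype [range F] of [W]. *)
Definition classF : set (X * Y * Z -> W) :=
  [set F | exists (G : UJ * Z -> range F) (H : X * UK -> range F),
     forall x y z,
       F (x, y, z) = \val (G (J (x, y), z)) /\
       F (x, y, z) = \val (H (x, K (y, z)))].

Definition section1 (b : X) : Y -> UJ := fun y => J (b, y).

(* When [range J] is contained in the domain of [j], as it is for
   quasi-inverses of [section1 b] with [range J = range (section1 b)], [j] is
   only evaluated on its domain. *)
Definition Sfun (j : pfun UJ Y) : X * Y * Z -> UK :=
  fun t => let: (x, y, z) := t in K (j (J (x, y)), z).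

End FJK.

(* Main.v *)
Require Import Defs.
From mathcomp Require Import all_boot.
From mathcomp Require Import boolp classical_sets.

Local Open Scope classical_set_scope.

(** Through [G], [F] sees [(x, y)] only via [J (x, y)], so [(x, y)] may be replaced by
    [(b, j (J (x, y)))], which has the same [J]-value. With the first argument frozen at [b], [H]
    shows that [F] depends only on the [K]-value; hence [g] is [H (b, _)], whatever [j] is. *)

Theorem theorem6 (X Y Z UJ UK W : Type)
  (hX : inhabited X) (hY : inhabited Y) (hZ : inhabited Z)
  (hUJ : inhabited UJ) (hUK : inhabited UK)
  (J : X * Y -> UJ) (K : Y * Z -> UK) (b : X)
  (hb : range J = range (section1 J b))
  (F : X * Y * Z -> W) (hF : classF J K F) :
  exists g : UK -> range F,
    forall j : pfun UJ Y, quasi_inverses (pf_total (section1 J b)) j ->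
      F = \val \o g \o Sfun J K j.
Proof.
have [G [H FGH]] := hF.
exists (fun u => H (b, u)) => j [_ _ jK _].
apply/funext => -[[x y] z] /=.
have Jjb : J (b, j (J (x, y))) = J (x, y).
  apply: (jK (J (x, y))).
  have : range J (J (x, y)) by exists (x, y).
  by rewrite hb.
(* [-Jjb] also rewrites [J (x, y)] under [K] on the right; the final [Jjb] undoes this. *)
rewrite (FGH x y z).1 -Jjb -(FGH b _ z).1 Jjb.
exact: (FGH b _ z).2.
Qed.
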